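(* Let $G$ be a finite group acting by automorphisms on a ring $A$, let $R=G*A$ be the associated crossed product, let $R^*=\mathrm{Hom}_A(R_A,A_A)$ be its right dual with its $A$-coring structure, and let $\mathfrak{t}:R\to A$, $\mathfrak{t}(\sum_{x\in G}x a_x)=\sum_{x\in G}a_x$, be the trace map, which is a grouplike element of $R^*$. Let $\Theta:\mathbf{Gr}(R^* )\to Z^1(G^{op},U(A))$ be the bijection which sends a grouplike element $h$ to its restriction to $G$, $x\mapsto h(x)$. Then $\Theta$ induces an isomorphism of pointed sets $$\mathscr{D}^1(R^*,\mathfrak{t})\;\cong\;\mathscr{H}^1(G^{op},U(A)),$$ and there is an equality of groups $$\mathscr{D}^0(R^*,\mathfrak{t})\;=\;\mathscr{H}^0(G^{op},U(A)).$$
   Context: Rings are associative with unit; $U(A)$ is the group of units of $A$. Corings. An $A$-coring is an $A$-bimodule $\mathfrak{C}$ with $A$-bimodule maps $\Delta:\mathfrak{C}\to\mathfrak{C}\otimes_A\mathfrak{C}$ and $\varepsilon:\mathfrak{C}\to A$ satisfying the coassociativity and counit axioms. A grouplike element is $g\in\mathfrak{C}$ with $\Delta(g)=g\otimes_A g$ and $\varepsilon(g)=1$; $\mathbf{Gr}(\mathfrak{C})$ is the set of grouplike elements. For $g\in\mathbf{Gr}(\mathfrak{C})$, $A^g=\{a\in A: ag=ga\}$ is the subring of $g$-coinvariants. The group $U(A)$ acts on $\mathbf{Gr}(\mathfrak{C})$ by $(\alpha,g)\mapsto\alpha g\alpha^{-1}$; the first descent cohomology $\mathscr{D}^1(\mathfrak{C},g)$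 of $\mathfrak{C}$ at $g$ is the set of orbits of this action, pointed by the orbit of $g$. The zeroth descent cohomology group is $\mathscr{D}^0(\mathfrak{C},g)=U(A^g)$. Crossed product. $G$ acts on $A$ by ring automorphisms $a\mapsto x(a)$, $x\in G$. For $a\in A$, $x\in G$ put $a^x=x^{-1}(a)$, so that $(a^x)^y=a^{xy}$; this is the induced action of the opposite group $G^{op}$ on $A$ (and on $U(A)$). $R=G*A$ is the free right $A$-module with basis $G$, with multiplication $(xa)(yb)=(xy)\,a^y b$, i.e. $ay=y\,a^y$ in $R$. The coring $R^*$. $R^*=\mathrm{Hom}_A(R_A,A_A)$ is the set of right $A$-linear maps $R\to A$, with bimodule structure $(a\varphi b)(r)=a\varphi(br)$. Let $\{x,x^*\}_{x\in G}$ be the dual basis of $R_A$ given by $G$. The coring structure is $\Delta(\varphi)=\sum_{x\in G}\varphi x\otimes_A x^*$, where $(\varphi x)(r)=\varphi(xr)$, and $\varepsilon(\varphi)=\varphi(1_R)$. Non-abelian cohomology (Serre). $Z^1(G^{op},U(A))$ is the set of maps $f:G\to U(A)$ with $f(xy)=f(y)\,f(x)^y$ for all $x,y\in G$ (product $xy$ taken in $G$), pointed by the trivial cocycle $x\mapsto 1$. Two 1-cocycles $f,h$ are cohomologous if there is $\alpha\in U(A)$ with $f(x)=\alpha^{-1}h(x)\alpha^x$ for all $x$. $\mathscr{H}^1(G^{op},U(A))$ is the pointed set of cohomology classes, pointed by the class of the trivial cocycle, and $\mathscr{H}^0(G^{op},U(A))=\{\alpha\in U(A):\alpha^x=\alpha\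 \forall x\in G\}$. *)

(* Defs.v *)
From HB Require Import structures.
From mathcomp Require Import all_boot fingroup generic_quotient all_algebra.
From mathcomp Require Import boolp classical_sets functions.
From mathcomp Require Import freeg.

Set Implicit Arguments.
Unset Strict Implicit.
Unset Printing Implicit Defensive.

Import GRing.Theory.
Local Open Scope ring_scope.
Local Open Scope quotient_scope.
Import Quotient.

Reserved Notation "M \ot N" (at level 40, left associativity).

(* U(A), each unit carried together with its two-sided inverse. *)
Record units (A : pzRingType) := Units {
  units_pair : A * A;
  _ : (units_pair.1 * units_pair.2 == 1) && (units_pair.2 * units_pair.1 == 1)
}.
HB.instance Definition _ A := [isSub for @units_pair A].
HB.instance Definition _ A := [Choice of units A by <:].

Definition uval A (u : units A) : A := (units_pair u).1.
Coercion uval : units >-> GRing.PzRing.sort.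

Section UnitGroup.
Variable A : pzRingType.
Implicit Types u v w : units A.

Fact unit1_subproof : (1 * 1 == 1 :> A) && (1 * 1 == 1 :> A).
Proof. by rewrite mulr1 eqxx. Qed.
Definition unit1 : units A := @Units A (1, 1) unit1_subproof.

Fact unitV_subproof u :
  ((units_pair u).2 * (units_pair u).1 == 1)
    && ((units_pair u).1 * (units_pair u).2 == 1).
Proof. by case: u => p /=; rewrite andbC. Qed.
Definition unitV u : units A :=
  @Units A ((units_pair u).2, (units_pair u).1) (unitV_subproof u).

Lemma mul_uvalV u : uval u * uval (unitV u) = 1.
Proof. by case: u => p /= up; case/andP: (up) => /eqP. Qed.
Lemma mul_uVval u : uval (unitV u) * uval u = 1.
Proof. by case: u => p /= up; case/andP: (up) => _ /eqP. Qed.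

Fact unitM_subproof u v :
  let p := (uval u * uval v, uval (unitV v) * uval (unitV u)) in
  (p.1 * p.2 == 1) && (p.2 * p.1 == 1).
Proof.
apply/andP; split; apply/eqP => /=.
  by rewrite mulrA -(mulrA (uval u)) mul_uvalV mulr1 mul_uvalV.
by rewrite mulrA -(mulrA _ (uval (unitV u))) mul_uVval mulr1 mul_uVval.
Qed.
Definition unitM u v : units A := @Units A _ (unitM_subproof u v).

Lemma uval_inj : injective (@uval A).
Proof.
move=> u v uv; apply/val_inj => /=; rewrite [LHS]surjective_pairing.
rewrite [RHS]surjective_pairing; congr (_, _); first exact: uv.
change (uval (unitV u) = uval (unitV v)).
by rewrite -[LHS]mulr1 -(mul_uvalV v) -uv mulrA mul_uVval mul1r.
Qed.

Fact unitMA : associative unitM.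
Proof. by move=> u v w; apply: uval_inj; rewrite /= /uval /= mulrA. Qed.
Fact unit1M : left_id unit1 unitM.
Proof. by move=> u; apply: uval_inj; rewrite /uval /= mul1r. Qed.
Fact unitM1 : right_id unit1 unitM.
Proof. by move=> u; apply: uval_inj; rewrite /uval /= mulr1. Qed.
Fact unitVM : left_inverse unit1 unitV unitM.
Proof. by move=> u; apply: uval_inj; exact: mul_uVval. Qed.
Fact unitMV : right_inverse unit1 unitV unitM.
Proof. by move=> u; apply: uval_inj; exact: mul_uvalV. Qed.

HB.instance Definition _ :=
  isGroup.Build (units A) unitMA unit1M unitM1 unitVM unitMV.

Lemma uval1 : uval (1%g : units A) = 1. Proof. by []. Qed.
Lemma uvalM u v : uval (u * v)%g = uval u * uval v. Proof. by []. Qed.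
Lemma uvalMV u : uval u * uval u^-1%g = 1. Proof. exact: mul_uvalV. Qed.
Lemma uvalVM u : uval u^-1%g * uval u = 1. Proof. exact: mul_uVval. Qed.

End UnitGroup.

(* For a subring S of A, the group U(S), as a subgroup of U(A): the elements of
   S having an inverse in S. *)
Section UnitsIn.
Variables (A : pzRingType) (S : subringClosed A).

Definition units_in : {pred units A} :=
  fun u => (uval u \in S) && (uval u^-1%g \in S).

Fact units_inV : invg_closed units_in.
Proof. by move=> u /andP[Su SVu]; rewrite unfold_in invgK Su SVu. Qed.
Fact units_in1 : 1%g \in units_in.
Proof. by rewrite unfold_in invg1 uval1 rpred1. Qed.
Fact units_inM : mulg_closed units_in.
Proof.
move=> u v /andP[Su SVu] /andP[Sv SVv].
by rewrite unfold_in invMg !uvalM !rpredM.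
Qed.
HB.instance Definition _ := isMulClosed.Build (units A) units_in units_inM.
HB.instance Definition _ := isMul1Closed.Build (units A) units_in units_in1.
HB.instance Definition _ := isInvClosed.Build (units A) units_in units_inV.
End UnitsIn.

HB.mixin Record Lmodule_isBimodule (A : pzRingType) M of GRing.Lmodule A M := {
  rscale : M -> A -> M;
  rscale_subproof : forall m a b, rscale (rscale m a) b = rscale m (a * b);
  rscale1_subproof : forall m, rscale m 1 = m;
  rscaleDl_subproof : forall m n a,
    rscale (m + n) a = rscale m a + rscale n a;
  rscaleDr_subproof : forall m a b,
    rscale m (a + b) = rscale m a + rscale m b;
  scale_rscale_subproof : forall a m b,
    a *: rscale m b = rscale (a *: m) b
}.
#[short(type="bimodType")]
HB.structure Definition Bimodule (A : pzRingType) :=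
  {M of Lmodule_isBimodule A M & GRing.Lmodule A M}.

Notation "m :* a" := (rscale m a) : ring_scope.

Section BimoduleTheory.
Variables (A : pzRingType) (M : bimodType A).
Implicit Types (m n : M) (a b : A).
Lemma rscaleA m a b : m :* a :* b = m :* (a * b).
Proof. exact: rscale_subproof. Qed.
Lemma rscale1 m : m :* 1 = m.
Proof. exact: rscale1_subproof. Qed.
Lemma rscaleDl m n a : (m + n) :* a = m :* a + n :* a.
Proof. exact: rscaleDl_subproof. Qed.
Lemma rscaleDr m a b : m :* (a + b) = m :* a + m :* b.
Proof. exact: rscaleDr_subproof. Qed.
Lemma scale_rscale a m b : a *: (m :* b) = (a *: m) :* b.
Proof. exact: scale_rscale_subproof. Qed.
End BimoduleTheory.

HB.instance Definition _ (A : pzRingType) :=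
  @Lmodule_isBimodule.Build A A^o (fun m a => (m : A) * a)
    (fun m a b => esym (mulrA (m : A) a b)) (@mulr1 A)
    (fun m n a => mulrDl (m : A) n a) (fun m a b => mulrDr (m : A) a b)
    (fun a m b => mulrA a (m : A) b).

Definition bimod_morphism (A : pzRingType) (M N : bimodType A) (f : M -> N) :=
  [/\ {morph f : m n / m + n},
      forall a m, f (a *: m) = a *: f m &
      forall m a, f (m :* a) = f m :* a].

Lemma morphD0 (U V : zmodType) (h : U -> V) :
  {morph h : s t / s + t} -> h 0 = 0.
Proof. by move=> hD; apply: (addrI (h 0)); rewrite -hD !addr0. Qed.
Lemma morphD_sum (U V : zmodType) (h : U -> V) (I : finType) (u : I -> U) :
  {morph h : s t / s + t} -> h (\sum_i u i) = \sum_i h (u i).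
Proof. by move=> hD; exact: (big_morph h hD (morphD0 hD)). Qed.

Section TensorProduct.
Variables (A : pzRingType) (M N : bimodType A).

Local Notation F := {freeg (M * N)%type}.
Local Notation gen m n := (<< (m, n) >> : F).

Inductive tensor_relation : F -> Prop :=
| TensorDl m m' n : tensor_relation (gen (m + m') n - gen m n - gen m' n)
| TensorDr m n n' : tensor_relation (gen m (n + n') - gen m n - gen m n')
| TensorA m a n : tensor_relation (gen (m :* a) n - gen m (a *: n)).

(* The additive subgroup generated by the relations. *)
Definition tensor_null : {pred F} := fun u =>
  `[< forall S : zmodClosed F,
        (forall v, tensor_relation v -> v \in S) -> u \in S >].

Fact tensor_null_closed : zmod_closed tensor_null.
Proof.
split=> [|u v /asboolP Hu /asboolP Hv]; apply/asboolP => S relS.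
  exact: rpred0.
by rewrite rpredB ?Hu ?Hv.
Qed.
HB.instance Definition _ := GRing.isZmodClosed.Build F tensor_null
  tensor_null_closed.

Definition tensor_subgroup : zmodClosed F := tensor_null.
Definition tensor : Type := {quot tensor_subgroup}.
HB.instance Definition _ := GRing.Zmodule.on tensor.

Definition tmk (m : M) (n : N) : tensor := \pi_({quot tensor_subgroup}) (gen m n).

Let piD (u v : F) : \pi_{quot tensor_subgroup} (u + v)
  = \pi_{quot tensor_subgroup} u + \pi_{quot tensor_subgroup} v.
Proof. exact: pi_addr. Qed.

Lemma tmk_rel u : tensor_relation u -> u \in tensor_null.
Proof. by move=> ru; apply/asboolP => S; apply. Qed.

Lemma tmkDl m m' n : tmk (m + m') n = tmk m n + tmk m' n.
Proof.
apply/eqP; rewrite /tmk -piD -Quotient.idealrBE opprD addrA.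
exact/tmk_rel/TensorDl.
Qed.
Lemma tmkDr m n n' : tmk m (n + n') = tmk m n + tmk m n'.
Proof.
apply/eqP; rewrite /tmk -piD -Quotient.idealrBE opprD addrA.
exact/tmk_rel/TensorDr.
Qed.
Lemma tmkA m a n : tmk (m :* a) n = tmk m (a *: n).
Proof. by apply/eqP; rewrite -Quotient.idealrBE; exact/tmk_rel/TensorA. Qed.

(* The additive map on M \ot N sending m \ot n to f m n; meaningful when f is
   biadditive and A-balanced. *)
Definition tensor_lift (Z : zmodType) (f : M -> N -> Z) (t : tensor) : Z :=
  fglift (fun p : M * N => f p.1 p.2 : zmodule Z) (repr (t : {quot tensor_subgroup})).

Definition balanced (Z : zmodType) (f : M -> N -> Z) :=
  [/\ forall m m' n, f (m + m') n = f m n + f m' n,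
      forall m n n', f m (n + n') = f m n + f m n' &
      forall m a n, f (m :* a) n = f m (a *: n)].

Section Lift.
Variables (Z : zmodType) (f : M -> N -> Z).
Hypothesis fbal : balanced f.

Local Notation lf := (fglift (fun p : M * N => f p.1 p.2 : zmodule Z)).
Let lfB : {morph lf : u v / u - v}.
Proof. exact: lift_is_additive. Qed.
Let lf0 : lf 0 = 0. Proof. by rewrite -(subr0 0) lfB subrr. Qed.
Let lfU m n : lf (gen m n) = f m n.
Proof. by rewrite liftU scale1r. Qed.

Let lf_null u : u \in tensor_null -> lf u = 0.
Proof.
pose S : pred F := fun u => lf u == 0.
have SB : zmod_closed S.
  split=> [|v w /eqP Hv /eqP Hw]; first by rewrite unfold_in /= lf0.
  by rewrite unfold_in /= lfB Hv Hw subr0.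
pose cS := GRing.isZmodClosed.Build F S SB.
pose zS : zmodClosed F := HB.pack S cS.
move=> /asboolP /(_ zS) H; apply/eqP; apply: H => v.
case: fbal => fDl fDr fA.
by case=> *; apply/eqP; rewrite /= !lfB !lfU ?fDl ?fDr ?fA ?subrr // addrAC addrK subrr.
Qed.

Let lift_pi (u : F) : tensor_lift f (\pi_({quot tensor_subgroup}) u) = lf u.
Proof.
apply/eqP; rewrite -subr_eq0 /tensor_lift -lfB; apply/eqP/lf_null.
by rewrite Quotient.idealrBE reprK.
Qed.

Lemma tensor_liftE m n : tensor_lift f (tmk m n) = f m n.
Proof. by rewrite lift_pi lfU. Qed.

Lemma tensor_liftB : {morph tensor_lift f : s t / s - t}.
Proof.
by elim/quotW => u; elim/quotW => v; rewrite -raddfB !lift_pi lfB.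
Qed.
End Lift.

Lemma tensor_ext (Z : zmodType) (f g : tensor -> Z) :
  {morph f : s t / s + t} -> {morph g : s t / s + t} ->
  (forall m n, f (tmk m n) = g (tmk m n)) -> f =1 g.
Proof.
move=> fD gD fg.
have morphN (h : tensor -> Z) t : {morph h : s t / s + t} -> h (- t) = - h t.
  by move=> hD; apply/eqP; rewrite -addr_eq0 -hD addNr (morphD0 hD).
elim/quotW => u; elim/freeg_ind_dom0: u => [|k [m n] u _ _ IH].
  by rewrite raddf0 (morphD0 fD) (morphD0 gD).
rewrite raddfD fD gD IH; congr (_ + _); rewrite -[k]intz.
rewrite -freegU_mulz raddfMz /=.
have pn (h : tensor -> Z) (j : nat) : {morph h : s t / s + t} ->
    h (tmk m n *+ j) = h (tmk m n) *+ j.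
  by move=> hD; elim: j => [|j IHj]; rewrite ?mulr0n ?(morphD0 hD) // !mulrS hD IHj.
case: k => j; first by rewrite -!pmulrn !pn ?fg.
by rewrite NegzE !mulrNz -!pmulrn !morphN // !pn ?fg.
Qed.

End TensorProduct.

Notation "m \ot n" := (tmk m n) : ring_scope.

Section TensorBimodule.
Variables (A : pzRingType) (M N : bimodType A).
Implicit Types (t : tensor M N).

Lemma tensor_liftD (Z : zmodType) (f : M -> N -> Z) :
  balanced f -> {morph tensor_lift f : s t / s + t}.
Proof.
move=> bf s t; have fB := tensor_liftB bf.
have fN u : tensor_lift f (- u) = - tensor_lift f u.
  by rewrite -[- u]sub0r fB -[X in tensor_lift f X](subrr u) fB subrr sub0r.
by rewrite -[t in LHS]opprK fB fN opprK.
Qed.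

Definition tscale a t : tensor M N := tensor_lift (fun m n => (a *: m) \ot n) t.
Definition trscale t a : tensor M N := tensor_lift (fun m n => m \ot (n :* a)) t.

Let tscale_bal a : balanced (fun (m : M) (n : N) => (a *: m) \ot n).
Proof.
by split=> *; rewrite ?scalerDr ?tmkDl ?tmkDr // scale_rscale tmkA.
Qed.
Let trscale_bal a : balanced (fun (m : M) (n : N) => m \ot (n :* a)).
Proof.
by split=> *; rewrite ?rscaleDl ?tmkDl ?tmkDr // tmkA scale_rscale.
Qed.

Lemma tscaleE a m n : tscale a (m \ot n) = (a *: m) \ot n.
Proof. exact: (tensor_liftE (tscale_bal a)). Qed.
Lemma trscaleE m n a : trscale (m \ot n) a = m \ot (n :* a).
Proof. exact: (tensor_liftE (trscale_bal a)). Qed.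

Fact tscaleDr a : {morph tscale a : s t / s + t}.
Proof. exact: (tensor_liftD (tscale_bal a)). Qed.
Fact trscaleDl a : {morph trscale^~ a : s t / s + t}.
Proof. exact: (tensor_liftD (trscale_bal a)). Qed.

Fact tscaleA a b t : tscale a (tscale b t) = tscale (a * b) t.
Proof.
apply: (tensor_ext (f := fun t => tscale a (tscale b t)));
  do ?by move=> s s' /=; rewrite !tscaleDr.
by move=> m n; rewrite !tscaleE scalerA.
Qed.
Fact tscale1 : left_id 1 tscale.
Proof.
move=> t; apply: (tensor_ext (g := id)) => [||m n] //; first exact: tscaleDr.
by rewrite tscaleE scale1r.
Qed.
Fact tscaleDl t a b : tscale (a + b) t = tscale a t + tscale b t.
Proof.
apply: (tensor_ext (g := fun t => tscale a t + tscale b t)) => [||m n].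
- exact: tscaleDr.
- by move=> s s' /=; rewrite !tscaleDr addrACA.
- by rewrite !tscaleE scalerDl tmkDl.
Qed.
HB.instance Definition _ := GRing.Zmodule_isLmodule.Build A (tensor M N)
  tscaleA tscale1 tscaleDr tscaleDl.

Fact trscaleA t a b : trscale (trscale t a) b = trscale t (a * b).
Proof.
apply: (tensor_ext (f := fun t => trscale (trscale t a) b)
                   (g := fun t => trscale t (a * b)));
  do ?by move=> s s' /=; rewrite !trscaleDl.
by move=> m n; rewrite !trscaleE rscaleA.
Qed.
Fact trscale1 t : trscale t 1 = t.
Proof.
apply: (tensor_ext (f := trscale^~ 1) (g := id)) => [||m n] //.
  exact: trscaleDl.
by rewrite trscaleE rscale1.
Qed.
Fact trscaleDr t a b : trscale t (a + b) = trscale t a + trscale t b.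
Proof.
apply: (tensor_ext (f := trscale^~ (a + b))
                   (g := fun t => trscale t a + trscale t b)) => [||m n].
- exact: trscaleDl.
- by move=> s s' /=; rewrite !trscaleDl addrACA.
- by rewrite !trscaleE rscaleDr tmkDr.
Qed.
Fact tscale_trscale a t b : a *: trscale t b = trscale (a *: t) b.
Proof.
apply: (tensor_ext (f := fun t => tscale a (trscale t b))
                   (g := fun t => trscale (tscale a t) b));
  do ?by move=> s s' /=; rewrite !(trscaleDl, tscaleDr).
by move=> m n; rewrite !(trscaleE, tscaleE).
Qed.
HB.instance Definition _ := Lmodule_isBimodule.Build A (tensor M N)
  trscaleA trscale1 (fun s t a => trscaleDl a s t) trscaleDr tscale_trscale.

Lemma scale_tmk a (m : M) (n : N) : a *: (m \ot n) = (a *: m) \ot n.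
Proof. exact: tscaleE. Qed.
Lemma rscale_tmk (m : M) (n : N) a : (m \ot n) :* a = m \ot (n :* a).
Proof. exact: trscaleE. Qed.

End TensorBimodule.

Definition tensor_map (A : pzRingType) (M M' N N' : bimodType A)
    (f : M -> M') (g : N -> N') : tensor M N -> tensor M' N' :=
  tensor_lift (fun m n => f m \ot g n).

Definition tensor_assoc (A : pzRingType) (M N P : bimodType A) :
    tensor (tensor M N) P -> tensor M (tensor N P) :=
  tensor_lift (fun t p => tensor_lift (fun m n => m \ot (n \ot p)) t).

Lemma tensor_mapE (A : pzRingType) (M M' N N' : bimodType A)
    (f : M -> M') (g : N -> N') : bimod_morphism f -> bimod_morphism g ->
  forall m n, tensor_map f g (m \ot n) = f m \ot g n.
Proof.
move=> [fD fZ fR] [gD gZ gR] m n; rewrite /tensor_map tensor_liftE //.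
by split=> *; rewrite ?fD ?gD ?tmkDl ?tmkDr // fR gZ tmkA.
Qed.

Lemma tensor_mapD (A : pzRingType) (M M' N N' : bimodType A)
    (f : M -> M') (g : N -> N') : bimod_morphism f -> bimod_morphism g ->
  {morph tensor_map f g : s t / s + t}.
Proof.
move=> [fD fZ fR] [gD gZ gR]; apply: tensor_liftD.
by split=> *; rewrite ?fD ?gD ?tmkDl ?tmkDr // fR gZ tmkA.
Qed.

Lemma bimod_morphism_id (A : pzRingType) (M : bimodType A) :
  bimod_morphism (@id M).
Proof. by []. Qed.

Section TensorAssoc.
Variables (A : pzRingType) (M N P : bimodType A).

Let assoc_bal1 (p : P) : balanced (fun (m : M) (n : N) => m \ot (n \ot p)).
Proof. by split=> *; rewrite ?tmkDl ?tmkDr // tmkA scale_tmk. Qed.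

Let assoc_bal2 : balanced (fun (t : tensor M N) (p : P) =>
  tensor_lift (fun m n => m \ot (n \ot p)) t).
Proof.
split=> [t t' p|t p p'|t a p].
- by rewrite tensor_liftD.
- apply: (tensor_ext (g := fun t => tensor_lift (fun m n => m \ot (n \ot p)) t
    + tensor_lift (fun m n => m \ot (n \ot p')) t)) => [||m n].
  + exact: tensor_liftD.
  + by move=> s s'; rewrite !tensor_liftD // addrACA.
  + by rewrite !tensor_liftE // !tmkDr.
- apply: (tensor_ext (f := fun t => tensor_lift _ (t :* a))) => [||m n].
  + by move=> s s'; rewrite rscaleDl tensor_liftD.
  + exact: tensor_liftD.
  + by rewrite rscale_tmk !tensor_liftE // tmkA.
Qed.

Lemma tensor_assocE (m : M) (n : N) (p : P) :
  tensor_assoc ((m \ot n) \ot p) = m \ot (n \ot p).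
Proof. by rewrite /tensor_assoc !tensor_liftE. Qed.

Lemma tensor_assocD : {morph @tensor_assoc A M N P : s t / s + t}.
Proof. exact: tensor_liftD. Qed.
End TensorAssoc.

(* The two counit axioms are (counit \ot C) \o comul = id and
   (C \ot counit) \o comul = id, up to the canonical isomorphisms
   A \ot C = C and C \ot A = C. *)
HB.mixin Record Bimodule_isCoring (A : pzRingType) C of Bimodule A C := {
  comul : C -> tensor C C;
  counit : C -> A^o;
  comul_morphism : bimod_morphism comul;
  counit_morphism : bimod_morphism counit;
  comulA : forall c,
    tensor_assoc (tensor_map comul id (comul c)) = tensor_map id comul (comul c);
  comul_counitl : forall c,
    tensor_lift (fun d e : C => (counit d : A) *: e) (comul c) = c;
  comul_counitr : forall c,
    tensor_lift (fun d e : C => d :* (counit e : A)) (comul c) = c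
}.
#[short(type="coringType")]
HB.structure Definition Coring (A : pzRingType) :=
  {C of Bimodule_isCoring A C & Bimodule A C}.

Section Grouplike.
Variables (A : pzRingType) (C : coringType A).

Definition grouplike : pred C :=
  fun g => (comul g == g \ot g) && (counit g == (1 : A)).

Record gr := Gr { gr_val :> C; _ : grouplike gr_val }.
HB.instance Definition _ := [isSub for gr_val].
HB.instance Definition _ := [Choice of gr by <:].

Lemma gr_comul (g : gr) : comul (g : C) = (g : C) \ot (g : C).
Proof. by case: g => g /= /andP[/eqP]. Qed.
Lemma gr_counit (g : gr) : counit (g : C) = (1 : A).
Proof. by case: g => g /= /andP[_ /eqP]. Qed.

Fact gr_conj_subproof (u : units A) (g : gr) :
  grouplike ((uval u *: (g : C)) :* uval u^-1%g).
Proof.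
apply/andP; split; apply/eqP.
  have [_ DZ DR] := @comul_morphism A C.
  rewrite DR DZ gr_comul scale_tmk rscale_tmk tmkA.
  by rewrite scale_rscale scalerA uvalVM scale1r.
have [_ eZ eR] := @counit_morphism A C.
by rewrite eR eZ gr_counit /= -[RHS](uvalMV u); congr (_ * _); exact: mulr1.
Qed.
Definition gr_conj u g : gr := Gr (gr_conj_subproof u g).

Lemma gr_conj1 g : gr_conj 1%g g = g.
Proof. by apply/val_inj; rewrite /= invg1 scale1r rscale1. Qed.
Lemma gr_conjM u v g : gr_conj (u * v)%g g = gr_conj u (gr_conj v g).
Proof.
by apply/val_inj; rewrite /= invMg !uvalM -scalerA -rscaleA !scale_rscale.
Qed.

Definition coinvariants (g : gr) : {pred A} :=
  fun a => a *: (g : C) == (g : C) :* a.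

Fact coinvariants_closed g : subring_closed (coinvariants g).
Proof.
split=> [|a b /eqP Ha /eqP Hb|a b /eqP Ha /eqP Hb]; apply/eqP.
- by rewrite scale1r rscale1.
- by apply: (addIr ((g : C) :* b)); rewrite -rscaleDr subrK scalerBl -Hb subrK.
- by rewrite -scalerA Hb scale_rscale Ha rscaleA.
Qed.
HB.instance Definition _ g := GRing.isSubringClosed.Build A (coinvariants g)
  (coinvariants_closed g).

Definition D0 (g : gr) : groupClosed (units A) := units_in (coinvariants g).

Definition gr_orbit_rel (h k : gr) : bool :=
  `[< exists u : units A, k = gr_conj u h >].

Fact gr_orbit_refl : reflexive gr_orbit_rel.
Proof. by move=> h; apply/asboolP; exists 1%g; rewrite gr_conj1. Qed.
Fact gr_orbit_sym : symmetric gr_orbit_rel.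
Proof.
move=> h k; apply/asboolP/asboolP => -[u ->]; exists u^-1%g;
  by rewrite -gr_conjM mulVg gr_conj1.
Qed.
Fact gr_orbit_trans : transitive gr_orbit_rel.
Proof.
move=> h k l /asboolP[u ->] /asboolP[v ->]; apply/asboolP; exists (v * u)%g.
by rewrite gr_conjM.
Qed.
Canonical gr_orbit_equiv :=
  EquivRel gr_orbit_rel gr_orbit_refl gr_orbit_sym gr_orbit_trans.

(* The set of orbits does not depend on g, which only fixes the base point. *)
Definition D1 (g : gr) : Type := {eq_quot gr_orbit_rel}.
HB.instance Definition _ g := Choice.on (D1 g).
Definition gr_orbit (g h : gr) : D1 g := \pi_{eq_quot gr_orbit_rel} h.
HB.instance Definition _ g := isPointed.Build (D1 g) (gr_orbit g g).

End Grouplike.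
Arguments gr {A} C.

Section RightDual.
Variables (A : pzRingType) (M : bimodType A).

Definition right_linear : pred (M -> A) := fun f =>
  `[< (forall m n, f (m + n) = f m + f n) /\
      (forall m a, f (m :* a) = f m * a) >].

Record rdual := RDual { rdual_fun :> M -> A; _ : right_linear rdual_fun }.
HB.instance Definition _ := [isSub for rdual_fun].
HB.instance Definition _ := [Choice of rdual by <:].

Implicit Types (f g : rdual).
Lemma rdualD f : {morph f : m n / m + n}.
Proof. by case: f => f /= /asboolP[]. Qed.
Lemma rdualR f m a : f (m :* a) = f m * a.
Proof. by case: f => f /= /asboolP[]. Qed.
Lemma rdualP f g : f =1 g -> f = g.
Proof. by move=> fg; apply/val_inj/funext. Qed.

Fact rdual_closed : zmod_closed right_linear.
Proof.
split=> [|f g /asboolP[fD fR] /asboolP[gD gR]]; apply/asboolP; split=> *.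
- by rewrite /= addr0.
- by rewrite /= mul0r.
- by rewrite !fctE fD gD opprD addrACA.
- by rewrite !fctE fR gR mulrBl.
Qed.
HB.instance Definition _ := GRing.isZmodClosed.Build (M -> A) right_linear
  rdual_closed.
HB.instance Definition _ := [SubChoice_isSubZmodule of rdual by <:].

Lemma rdual_addE f g m : (f + g) m = f m + g m.
Proof. by []. Qed.

Fact rdual_scale_subproof a f : right_linear (fun m => a * f m).
Proof.
by apply/asboolP; split=> *; rewrite ?rdualD ?rdualR ?mulrDr ?mulrA.
Qed.
Definition rdual_scale a f : rdual := RDual (rdual_scale_subproof a f).

Fact rdual_rscale_subproof f b : right_linear (fun m => f (b *: m)).
Proof.
by apply/asboolP; split=> *; rewrite ?scalerDr ?scale_rscale ?rdualD ?rdualR.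
Qed.
Definition rdual_rscale f b : rdual := RDual (rdual_rscale_subproof f b).

Fact rdual_scaleA a b f : rdual_scale a (rdual_scale b f) = rdual_scale (a * b) f.
Proof. by apply/rdualP => m /=; rewrite mulrA. Qed.
Fact rdual_scale1 : left_id 1 rdual_scale.
Proof. by move=> f; apply/rdualP => m /=; rewrite mul1r. Qed.
Fact rdual_scaleDr : right_distributive rdual_scale +%R.
Proof. by move=> a f g; apply/rdualP => m /=; rewrite -mulrDr. Qed.
Fact rdual_scaleDl f : {morph rdual_scale^~ f : a b / a + b}.
Proof. by move=> a b; apply/rdualP => m /=; rewrite mulrDl. Qed.
HB.instance Definition _ := GRing.Zmodule_isLmodule.Build A rdual
  rdual_scaleA rdual_scale1 rdual_scaleDr rdual_scaleDl.

Fact rdual_rscaleA f a b :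
  rdual_rscale (rdual_rscale f a) b = rdual_rscale f (a * b).
Proof. by apply/rdualP => m /=; rewrite scalerA. Qed.
Fact rdual_rscale1 f : rdual_rscale f 1 = f.
Proof. by apply/rdualP => m /=; rewrite scale1r. Qed.
Fact rdual_rscaleDl f g a :
  rdual_rscale (f + g) a = rdual_rscale f a + rdual_rscale g a.
Proof. by apply/rdualP. Qed.
Fact rdual_rscaleDr f a b :
  rdual_rscale f (a + b) = rdual_rscale f a + rdual_rscale f b.
Proof. by apply/rdualP => m /=; rewrite scalerDl rdualD. Qed.
Fact rdual_scale_rscale a f b : a *: rdual_rscale f b = rdual_rscale (a *: f) b.
Proof. by apply/rdualP. Qed.
HB.instance Definition _ := Lmodule_isBimodule.Build A rdual
  rdual_rscaleA rdual_rscale1 rdual_rscaleDl rdual_rscaleDr rdual_scale_rscale.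

Lemma rdual_scaleE a f m : (a *: f) m = a * f m. Proof. by []. Qed.
Lemma rdual_rscaleE f b m : (f :* b) m = f (b *: m). Proof. by []. Qed.

End RightDual.

(* A left action; each ract x is an automorphism, with inverse ract x^-1. *)
Record ringAction (G : finGroupType) (A : pzRingType) := RingAction {
  ract :> G -> {rmorphism A -> A};
  ract1 : forall a, ract 1%g a = a;
  ractM : forall x y a, ract (x * y)%g a = ract x (ract y a)
}.

(* R = G * A; r : crossed act stands for the sum over x of x (ccoef r x). *)
Definition crossed (G : finGroupType) (A : pzRingType) (act : ringAction G A)
  : Type := {ffun G -> A}.

Section CrossedProduct.
Variables (G : finGroupType) (A : pzRingType) (act : ringAction G A).
Implicit Types (x y z : G) (a b : A).

(* a^x *)
Definition rexp a x : A := act x^-1%g a.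

Lemma rexp1 a : rexp a 1%g = a.
Proof. by rewrite /rexp invg1 ract1. Qed.
Lemma rexpA a x y : rexp (rexp a x) y = rexp a (x * y)%g.
Proof. by rewrite /rexp invMg ractM. Qed.
Lemma rexpM a b x : rexp (a * b) x = rexp a x * rexp b x.
Proof. exact: rmorphM. Qed.
Lemma rexpD a b x : rexp (a + b) x = rexp a x + rexp b x.
Proof. exact: rmorphD. Qed.
Lemma rexp_1 x : rexp 1 x = 1.
Proof. exact: rmorph1. Qed.
Lemma rexp_0 x : rexp 0 x = 0.
Proof. exact: rmorph0. Qed.

Local Notation crossed := (crossed act).
HB.instance Definition _ := GRing.Zmodule.on crossed.
Implicit Types (r s t : crossed).

Definition ccoef r : G -> A := fun_of_fin (r : {ffun G -> A}).

Lemma crossedP r s : ccoef r =1 ccoef s -> r = s.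
Proof. by move=> rs; apply/ffunP. Qed.
Lemma ccoefD r s x : ccoef (r + s) x = ccoef r x + ccoef s x.
Proof. exact: ffunE. Qed.

(* The element x a of R. *)
Definition monomial x a : crossed := [ffun y => if y == x then a else 0].

Lemma ccoef_monomial x a y : ccoef (monomial x a) y = if y == x then a else 0.
Proof. exact: ffunE. Qed.

(* Bilinear extension of (x a) (y b) = (x y) (a^y b), see monomialM. *)
Definition crossed_mul r s : crossed :=
  [ffun z => \sum_y rexp (ccoef r (z * y^-1)%g) y * ccoef s y].

Lemma ccoef_mul r s z :
  ccoef (crossed_mul r s) z = \sum_y rexp (ccoef r (z * y^-1)%g) y * ccoef s y.
Proof. exact: ffunE. Qed.

Fact crossed_mulA : associative crossed_mul.
Proof.
move=> r s t; apply/crossedP => z; rewrite !ccoef_mul.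
under eq_bigr do rewrite ccoef_mul mulr_sumr.
rewrite exchange_big; apply: eq_bigr => y _ /=; rewrite ccoef_mul.
rewrite /rexp raddf_sum mulr_suml (reindex_inj (mulIg y)) /=.
apply: eq_bigr => w _; rewrite mulgK rmorphM -!mulrA invMg ractM.
by rewrite mulgA.
Qed.
Fact crossed_mul1 : left_id (monomial 1%g 1) crossed_mul.
Proof.
move=> r; apply/crossedP => z; rewrite ccoef_mul (bigD1 z) //= mulgV.
rewrite ccoef_monomial eqxx rexp_1 mul1r big1 ?addr0 // => y yz.
by rewrite ccoef_monomial -eq_mulgV1 eq_sym (negPf yz) rexp_0 mul0r.
Qed.
Fact crossed_mulr1 : right_id (monomial 1%g 1) crossed_mul.
Proof.
move=> r; apply/crossedP => z; rewrite ccoef_mul (bigD1 1%g) //= invg1 mulg1.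
rewrite ccoef_monomial eqxx rexp1 mulr1 big1 ?addr0 // => y y1.
by rewrite ccoef_monomial (negPf y1) mulr0.
Qed.
Fact crossed_mulDl : left_distributive crossed_mul +%R.
Proof.
move=> r s t; apply/crossedP => z; rewrite ccoefD !ccoef_mul -big_split /=.
by apply: eq_bigr => y _; rewrite ccoefD rexpD mulrDl.
Qed.
Fact crossed_mulDr : right_distributive crossed_mul +%R.
Proof.
move=> r s t; apply/crossedP => z; rewrite ccoefD !ccoef_mul -big_split /=.
by apply: eq_bigr => y _; rewrite ccoefD mulrDr.
Qed.
HB.instance Definition _ := GRing.Zmodule_isPzRing.Build crossed
  crossed_mulA crossed_mul1 crossed_mulr1 crossed_mulDl crossed_mulDr.

Lemma ccoef_Mmonomial r y b z :
  ccoef (r * monomial y b) z = rexp (ccoef r (z * y^-1)%g) y * b.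
Proof.
rewrite [LHS]ccoef_mul (bigD1 y) //= ccoef_monomial eqxx big1 ?addr0 // => x xy.
by rewrite ccoef_monomial (negPf xy) mulr0.
Qed.
Lemma ccoef_monomialM x a s z :
  ccoef (monomial x a * s) z = rexp a (x^-1 * z)%g * ccoef s (x^-1 * z)%g.
Proof.
rewrite [LHS]ccoef_mul (bigD1 (x^-1 * z)%g) //= invMg invgK mulKVg.
rewrite ccoef_monomial eqxx big1 ?addr0 // => y yz.
rewrite ccoef_monomial ifF ?rexp_0 ?mul0r //.
by apply: contra_neqF yz => /eqP <-; rewrite invMg invgK mulgKV.
Qed.
Lemma monomialM x y a b :
  monomial x a * monomial y b = monomial (x * y)%g (rexp a y * b).
Proof.
apply/crossedP => z; rewrite ccoef_Mmonomial !ccoef_monomial.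
have -> : (z * y^-1 == x)%g = (z == x * y)%g.
  by apply/eqP/eqP => [<-|->]; rewrite ?mulgKV ?mulgK.
by case: eqP => // _; rewrite rexp_0 mul0r.
Qed.
Lemma monomialD x a b : monomial x (a + b) = monomial x a + monomial x b.
Proof.
apply/crossedP => z; rewrite ccoefD !ccoef_monomial.
by case: ifP; rewrite ?addr0.
Qed.
Lemma monomial_sum r : r = \sum_x monomial x (ccoef r x).
Proof.
apply/crossedP => z; have -> : ccoef (\sum_x monomial x (ccoef r x)) z =
    \sum_x ccoef (monomial x (ccoef r x)) z.
  by apply: (big_morph (fun r => ccoef r z)) => [s t|]; [exact: ccoefD|exact: ffunE].
rewrite (bigD1 z) //= ccoef_monomial eqxx big1 ?addr0 // => x xz.
by rewrite ccoef_monomial eq_sym (negPf xz).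
Qed.

(* R as an A-bimodule, by restriction along the inclusion a |-> 1 a. *)
Definition crossed_scale a r : crossed := monomial 1%g a * r.
Definition crossed_rscale r a : crossed := r * monomial 1%g a.

Fact crossed_scaleA a b r :
  crossed_scale a (crossed_scale b r) = crossed_scale (a * b) r.
Proof. by rewrite /crossed_scale mulrA monomialM mulg1 rexp1. Qed.
Fact crossed_scale1 : left_id 1 crossed_scale.
Proof. by move=> r; exact: mul1r. Qed.
Fact crossed_scaleDr : right_distributive crossed_scale +%R.
Proof. by move=> a r s; exact: mulrDr. Qed.
Fact crossed_scaleDl r : {morph crossed_scale^~ r : a b / a + b}.
Proof. by move=> a b; rewrite /crossed_scale monomialD mulrDl. Qed.
HB.instance Definition _ := GRing.Zmodule_isLmodule.Build A crossed
  crossed_scaleA crossed_scale1 crossed_scaleDr crossed_scaleDl.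

Fact crossed_rscaleA r a b :
  crossed_rscale (crossed_rscale r a) b = crossed_rscale r (a * b).
Proof. by rewrite /crossed_rscale -mulrA monomialM mulg1 rexp1. Qed.
Fact crossed_rscale1 r : crossed_rscale r 1 = r.
Proof. exact: mulr1. Qed.
Fact crossed_rscaleDl r s a :
  crossed_rscale (r + s) a = crossed_rscale r a + crossed_rscale s a.
Proof. exact: mulrDl. Qed.
Fact crossed_rscaleDr r a b :
  crossed_rscale r (a + b) = crossed_rscale r a + crossed_rscale r b.
Proof. by rewrite /crossed_rscale monomialD mulrDr. Qed.
Fact crossed_scale_rscale a r b :
  a *: crossed_rscale r b = crossed_rscale (a *: r) b.
Proof. exact: mulrA. Qed.
HB.instance Definition _ := Lmodule_isBimodule.Build A crossed
  crossed_rscaleA crossed_rscale1 crossed_rscaleDl crossed_rscaleDr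
  crossed_scale_rscale.

Lemma ccoef_scale a r z : ccoef (a *: r) z = rexp a z * ccoef r z.
Proof. by rewrite ccoef_monomialM invg1 mul1g. Qed.
Lemma ccoef_rscale r a z : ccoef (r :* a) z = ccoef r z * a.
Proof. by rewrite ccoef_Mmonomial invg1 mulg1 rexp1. Qed.

Definition crossed_dual : Type := rdual crossed.
HB.instance Definition _ := Bimodule.on crossed_dual.
Implicit Types (f g : crossed_dual).

Fact dual_basis_subproof x : right_linear (ccoef^~ x : crossed -> A).
Proof.
by apply/asboolP; split=> *; rewrite ?ccoefD ?ccoef_rscale.
Qed.
Definition dual_basis x : crossed_dual := RDual (dual_basis_subproof x).

Fact dual_act_subproof f s : right_linear (fun r : crossed => f (s * r)).
Proof.
apply/asboolP; split=> [r t|r a]; first by rewrite mulrDr rdualD.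
by rewrite -rdualR; congr (f _); exact: mulrA.
Qed.
Definition dual_act f s : crossed_dual := RDual (dual_act_subproof f s).

Lemma dualE f r : f r = \sum_x f (monomial x 1) * ccoef r x.
Proof.
rewrite {1}[r]monomial_sum.
have -> : f (\sum_x monomial x (ccoef r x)) = \sum_x f (monomial x (ccoef r x)).
  apply: (big_morph f); first exact: rdualD.
  by apply: (addrI (f 0)); rewrite -rdualD !addr0.
apply: eq_bigr => x _; rewrite -rdualR; congr (f _).
by apply: esym; rewrite [LHS]monomialM mulg1 rexp1 mul1r.
Qed.

Lemma dual_eq f g : (forall x, f (monomial x 1) = g (monomial x 1)) -> f = g.
Proof.
by move=> fg; apply: rdualP => r; rewrite !dualE; under eq_bigr do rewrite fg.
Qed.

Lemma dual_sumE (I : finType) (h : I -> crossed_dual) r :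
  (\sum_i h i : crossed_dual) r = \sum_i h i r.
Proof. by apply: (big_morph (fun f : crossed_dual => f r)). Qed.

Definition dual_comul f : tensor crossed_dual crossed_dual :=
  \sum_x dual_act f (monomial x 1) \ot dual_basis x.
Definition dual_counit f : A^o := f 1.

Fact dual_comul_morphism : bimod_morphism dual_comul.
Proof.
split=> [f g|a f|f a].
- rewrite /dual_comul -big_split /=; apply: eq_bigr => x _.
  by rewrite -tmkDl; congr (_ \ot _); apply: rdualP.
- rewrite /dual_comul scaler_sumr; apply: eq_bigr => x _.
  by rewrite scale_tmk; congr (_ \ot _); apply: rdualP.
- rewrite /dual_comul [RHS](_ : _ = \sum_x
      (dual_act f (monomial x 1) \ot dual_basis x) :* a); last first.
    apply: (morphD_sum (h := fun u => u :* a)) => u v.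
    exact: rscaleDl.
  apply: eq_bigr => x _; rewrite rscale_tmk.
  have -> : dual_basis x :* a = rexp a x *: dual_basis x.
    by apply: rdualP => r; exact: ccoef_scale.
  rewrite -tmkA; congr (_ \ot _); apply: rdualP => r /=.
  congr (f _); rewrite [LHS]mulrA [in RHS]mulrA !monomialM.
  by rewrite mul1g mulg1 mulr1 rexp_1 mul1r.
Qed.
Fact dual_counit_morphism : bimod_morphism dual_counit.
Proof.
split=> [f g|a f|f a] //.
rewrite /dual_counit rdual_rscaleE [RHS](_ : _ = f ((1 : crossed) :* a)).
  by congr (f _); rewrite [LHS]mulr1 [RHS]mul1r.
by rewrite rdualR.
Qed.

Fact dual_comulA f :
  tensor_assoc (tensor_map dual_comul id (dual_comul f))
  = tensor_map id dual_comul (dual_comul f).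
Proof.
have cm := dual_comul_morphism; have im := bimod_morphism_id crossed_dual.
rewrite {2 4}/dual_comul.
rewrite (morphD_sum _ (tensor_mapD cm im)).
rewrite (morphD_sum _ (tensor_mapD im cm)).
rewrite (morphD_sum _ (@tensor_assocD _ _ _ _)).
under eq_bigr => x _.
  rewrite tensor_mapE // {1}/dual_comul.
  rewrite (_ : (\sum_y _) \ot _ = \sum_y
    (dual_act (dual_act f (monomial x 1)) (monomial y 1) \ot dual_basis y)
       \ot dual_basis x); last first.
    apply: (big_morph (fun u => u \ot dual_basis x)); first by move=> *; rewrite tmkDl.
    by apply: (addrI (0 \ot dual_basis x)); rewrite -tmkDl !addr0.
  rewrite (morphD_sum _ (@tensor_assocD _ _ _ _)).
  rewrite (reindex_inj (mulgI x^-1%g)) /=.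
  under eq_bigr do rewrite tensor_assocE.
  over.
rewrite exchange_big; apply: eq_bigr => z _ /=.
rewrite tensor_mapE // /dual_comul.
rewrite (big_morph (fun u => dual_act f (monomial z 1) \ot u)
  (id1 := 0) (op1 := +%R)); last 2 first.
- by move=> *; rewrite tmkDr.
- by apply: (addrI (dual_act f (monomial z 1) \ot 0)); rewrite -tmkDr !addr0.
apply: eq_bigr => x _; congr (_ \ot (_ \ot _)); apply: rdualP => r /=.
  by rewrite mulrA monomialM mulKVg rexp_1 mulr1.
by rewrite ccoef_monomialM rexp_1 mul1r.
Qed.
Fact dual_counitl f :
  tensor_lift (fun g h : crossed_dual => (dual_counit g : A) *: h) (dual_comul f)
  = f.
Proof.
have [eD eZ eR] := dual_counit_morphism.
have bal : balanced (fun g h : crossed_dual => (dual_counit g : A) *: h).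
  by split=> *; rewrite ?eD ?eR ?scalerDr ?scalerDl ?scalerA.
rewrite (morphD_sum _ (tensor_liftD bal)).
apply: rdualP => r; rewrite dual_sumE dualE; apply: eq_bigr => x _.
by rewrite (tensor_liftE bal) rdual_scaleE /dual_counit /= mulr1.
Qed.
Fact dual_counitr f :
  tensor_lift (fun g h : crossed_dual => g :* (dual_counit h : A)) (dual_comul f)
  = f.
Proof.
have [eD eZ eR] := dual_counit_morphism.
have bal : balanced (fun g h : crossed_dual => g :* (dual_counit h : A)).
  by split=> *; rewrite ?eD ?eZ ?rscaleDl ?rscaleDr ?rscaleA.
rewrite (morphD_sum _ (tensor_liftD bal)).
apply: rdualP => r; rewrite dual_sumE (bigD1 1%g) //= (tensor_liftE bal).
rewrite rdual_rscaleE /dual_counit /= ccoef_monomial eqxx scale1r.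
rewrite (_ : monomial 1%g 1 * r = r); last exact: mul1r.
rewrite big1 ?addr0 // => x x1; rewrite (tensor_liftE bal).
rewrite rdual_rscaleE /dual_counit /= ccoef_monomial (negPf x1) scale0r mulr0.
by apply: (addrI (f 0)); rewrite -rdualD !addr0.
Qed.
HB.instance Definition _ := Bimodule_isCoring.Build A crossed_dual
  dual_comul_morphism dual_counit_morphism dual_comulA dual_counitl dual_counitr.

End CrossedProduct.

Section Trace.
Variables (G : finGroupType) (A : pzRingType) (act : ringAction G A).

Fact trace_subproof :
  right_linear (fun r : crossed act => \sum_x ccoef r x).
Proof.
apply/asboolP; split=> [r s|r a].
  by rewrite -big_split; apply: eq_bigr => x _; rewrite ccoefD.
by rewrite mulr_suml; apply: eq_bigr => x _; rewrite ccoef_rscale.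
Qed.
Definition trace_fun : crossed_dual act := RDual trace_subproof.

Lemma trace_monomial x a : trace_fun (monomial act x a) = a.
Proof.
rewrite /= (bigD1 x) //= ccoef_monomial eqxx big1 ?addr0 // => y yx.
by rewrite ccoef_monomial (negPf yx).
Qed.

Fact trace_grouplike : grouplike trace_fun.
Proof.
apply/andP; split; apply/eqP; last exact: trace_monomial.
have -> : trace_fun \ot trace_fun = \sum_x trace_fun \ot dual_basis act x.
  rewrite -(morphD_sum (h := tmk trace_fun)); last by move=> *; rewrite tmkDr.
  by congr (_ \ot _); apply: rdualP => r; rewrite dual_sumE.
apply: eq_bigr => x _; congr (_ \ot _); apply: dual_eq => y.
rewrite [LHS](_ : _ = trace_fun (monomial act (x * y)%g 1)).
  by rewrite !trace_monomial.
by congr (trace_fun _); rewrite monomialM rexp_1 mulr1.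
Qed.
Definition trace : gr (crossed_dual act) := Gr trace_grouplike.

End Trace.

Section NonabelianCohomology.
Variables (G : finGroupType) (A : pzRingType) (act : ringAction G A).
Implicit Types (u v : units A) (x y : G).

(* u^x *)
Fact uexp_subproof u x :
  let p := (rexp act (uval u) x, rexp act (uval u^-1%g) x) in
  (p.1 * p.2 == 1) && (p.2 * p.1 == 1).
Proof. by rewrite /= -!rexpM uvalMV uvalVM rexp_1 eqxx. Qed.
Definition uexp u x : units A := Units (uexp_subproof u x).

Lemma uval_exp u x : uval (uexp u x) = rexp act (uval u) x.
Proof. by []. Qed.
Lemma uexp1 x : uexp 1%g x = 1%g.
Proof. by apply: uval_inj; rewrite uval_exp rexp_1. Qed.
Lemma uexpM u v x : uexp (u * v)%g x = (uexp u x * uexp v x)%g.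
Proof. by apply: uval_inj; rewrite uval_exp rexpM. Qed.
Lemma uexpV u x : uexp u^-1%g x = (uexp u x)^-1%g.
Proof. exact: uval_inj. Qed.

Definition H0_pred : {pred units A} := fun u => [forall x, uexp u x == u].

Fact H0M : mulg_closed H0_pred.
Proof.
move=> u v /forallP Hu /forallP Hv; apply/forallP => x.
by rewrite uexpM (eqP (Hu x)) (eqP (Hv x)).
Qed.
Fact H01 : 1%g \in H0_pred.
Proof. by apply/forallP => x; rewrite uexp1. Qed.
Fact H0V : invg_closed H0_pred.
Proof.
by move=> u /forallP Hu; apply/forallP => x; rewrite uexpV (eqP (Hu x)).
Qed.
HB.instance Definition _ := isMulClosed.Build (units A) H0_pred H0M.
HB.instance Definition _ := isMul1Closed.Build (units A) H0_pred H01.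
HB.instance Definition _ := isInvClosed.Build (units A) H0_pred H0V.

Definition H0 : groupClosed (units A) := H0_pred.

Definition is_cocycle : pred {ffun G -> units A} := fun f =>
  [forall x, forall y, f (x * y)%g == (f y * uexp (f x) y)%g].

Record Z1 := Cocycle { cocycle_fun :> {ffun G -> units A}; _ : is_cocycle cocycle_fun }.
HB.instance Definition _ := [isSub for cocycle_fun].
HB.instance Definition _ := [Choice of Z1 by <:].

Fact trivial_cocycle_subproof : is_cocycle [ffun=> 1%g].
Proof.
by apply/forallP => x; apply/forallP => y; rewrite !ffunE uexp1 mulg1.
Qed.
Definition trivial_cocycle : Z1 := Cocycle trivial_cocycle_subproof.
HB.instance Definition _ := isPointed.Build Z1 trivial_cocycle.

Definition cohomologous (f h : Z1) : bool :=
  `[< exists u, forall x, f x = (u^-1 * h x * uexp u x)%g >].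

Fact cohomologous_refl : reflexive cohomologous.
Proof.
by move=> f; apply/asboolP; exists 1%g => x; rewrite uexp1 invg1 mul1g mulg1.
Qed.
Fact cohomologous_sym : symmetric cohomologous.
Proof.
move=> f h; apply/asboolP/asboolP => -[u fh]; exists u^-1%g => x;
  by rewrite fh uexpV invgK !mulgA mulgV mul1g mulgK.
Qed.
Fact cohomologous_trans : transitive cohomologous.
Proof.
move=> f h k /asboolP[u hf] /asboolP[v fk]; apply/asboolP.
by exists (v * u)%g => x; rewrite hf fk uexpM invMg !mulgA.
Qed.
Canonical cohomologous_equiv := EquivRel cohomologous
  cohomologous_refl cohomologous_sym cohomologous_trans.

Definition H1 : Type := {eq_quot cohomologous}.
HB.instance Definition _ := Choice.on H1.
Definition cohomology_class (f : Z1) : H1 := \pi_{eq_quot cohomologous} f.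
HB.instance Definition _ := isPointed.Build H1 (cohomology_class trivial_cocycle).

End NonabelianCohomology.

Section Theta.
Variables (G : finGroupType) (A : pzRingType) (act : ringAction G A).
Variable h : gr (crossed_dual act).

Local Notation hf := (gr_val h : crossed_dual act).

Lemma gr_dual_act x : dual_act hf (monomial act x 1) = hf :* hf (monomial act x 1).
Proof.
pose ev (f g : crossed_dual act) := f :* g (monomial act x 1).
have bal : balanced ev.
  rewrite /ev; split=> *; rewrite ?rscaleDl ?rdual_addE ?rscaleDr //.
  by rewrite rscaleA rdual_scaleE.
have := congr1 (tensor_lift ev) (gr_comul h).
rewrite (tensor_liftE bal) -[RHS]/(hf :* hf (monomial act x 1)) => <-.
rewrite -[comul _]/(dual_comul hf) (morphD_sum _ (tensor_liftD bal)).
rewrite (bigD1 x) //= (tensor_liftE bal) /ev /= ccoef_monomial eqxx rscale1.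
rewrite big1 ?addr0 // => y yx; rewrite (tensor_liftE bal) /ev /=.
rewrite ccoef_monomial (negPf yx) (morphD0 (h := rscale _)) // => a b.
exact: rscaleDr.
Qed.

Lemma gr_monomialM x y :
  hf (monomial act (x * y)%g 1)
  = hf (monomial act y 1) * rexp act (hf (monomial act x 1)) y.
Proof.
rewrite (_ : hf (monomial act (x * y)%g 1)
            = dual_act hf (monomial act x 1) (monomial act y 1)).
  rewrite gr_dual_act -[LHS]/(hf (_ *: monomial act y 1)) -rdualR.
  congr (hf _); rewrite [LHS]monomialM [RHS]monomialM.
  by rewrite mul1g mulg1 mulr1 rexp1 mul1r.
by congr (hf _); rewrite monomialM rexp_1 mulr1.
Qed.

Lemma gr_monomial1 : hf (monomial act 1%g 1) = 1.
Proof. by rewrite -[RHS](gr_counit h). Qed.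

Fact Theta_unit_subproof x :
  let p := (hf (monomial act x 1), rexp act (hf (monomial act x^-1%g 1)) x) in
  (p.1 * p.2 == 1) && (p.2 * p.1 == 1).
Proof.
rewrite /= -gr_monomialM mulVg gr_monomial1 eqxx /=.
by rewrite -[X in _ * X](rexp1 act) -(mulVg x) -rexpA -rexpM -gr_monomialM
  mulgV gr_monomial1 rexp_1.
Qed.
(* The inverse of h(x) is h(x^-1)^x. *)
Definition Theta_unit x : units A := Units (Theta_unit_subproof x).

Fact Theta_subproof : is_cocycle act [ffun x => Theta_unit x].
Proof.
apply/forallP => x; apply/forallP => y; apply/eqP/uval_inj; rewrite !ffunE.
exact: gr_monomialM.
Qed.
Definition Theta : Z1 act := Cocycle Theta_subproof.

Lemma ThetaE x : uval (Theta x) = hf (monomial act x 1).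
Proof. by rewrite ffunE. Qed.
End Theta.

(* Main.v *)
Require Import Defs.
From HB Require Import structures.
From mathcomp Require Import all_boot fingroup generic_quotient all_algebra.
From mathcomp Require Import boolp classical_sets functions.

(** Because R is free over A on G, an element of R^* is the same thing as an
arbitrary function G -> A, and everything in the theorem can be read off from
these functions.  Two formulas do the work, for f in R^*, b in A and x in G:
(f b)(x) = f(x) b^x, because b x = x b^x in R ([dual_rscale_monomial]), and
f = sum_x f(x) x^* ([dual_basis_expansion]).

The second formula turns f \ot f into sum_x (f f(x)) \ot x^*, which is the
comultiplication sum_x (f x) \ot x^* of f as soon as f x = f f(x) for all x.
Evaluated at y, the latter says f(xy) = f(y) f(x)^y, the cocycle identity.
So every cocycle extends, by right linearity, to a grouplike element; together
with the uniqueness of the extension this makes Theta bijective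
([Theta_bijective]).

The first formula gives (u h u^-1)(x) = u h(x) (u^-1)^x, so h and k lie in the
same U(A)-orbit exactly when their restrictions to G are cohomologous, by the
same unit u ([cohomologous_Theta]).  Hence Theta passes to a bijection of the
quotients ([eq_quot_bijection]), and it is pointed since t is 1 on G.

Applied to h = t, which is 1 on G, the first formula reads (a t)(x) = a and
(t a)(x) = a^x.  The coinvariants of t are therefore the invariants of G
([coinvariants_trace]), and the same holds for units since the inverse of an
invariant unit is invariant. *)

Set Implicit Arguments.
Unset Strict Implicit.
Unset Printing Implicit Defensive.

Import GRing.Theory.
Local Open Scope ring_scope.
Local Open Scope quotient_scope.

Lemma eq_quot_bijection (T U : choiceType) (e : equiv_rel T) (e' : equiv_rel U)
    (theta : T -> U) :
    bijective theta -> (forall x y, e' (theta x) (theta y) = e x y) ->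
  exists f : {eq_quot e} -> {eq_quot e'},
    bijective f /\ forall x, f (\pi_{eq_quot e} x) = \pi_{eq_quot e'} (theta x).
Proof.
move=> [psi thetaK psiK] theta_e.
pose f (q : {eq_quot e}) := \pi_{eq_quot e'} (theta (repr q)).
pose g (q : {eq_quot e'}) := \pi_{eq_quot e} (psi (repr q)).
have fE x : f (\pi x) = \pi_{eq_quot e'} (theta x).
  by apply/eqmodP; rewrite theta_e; apply/eqmodP; rewrite reprK.
have gE y : g (\pi y) = \pi_{eq_quot e} (psi y).
  by apply/eqmodP; rewrite -theta_e !psiK; apply/eqmodP; rewrite reprK.
exists f; split=> //; exists g; elim/quotW => x.
  by rewrite fE gE thetaK.
by rewrite gE fE psiK.
Qed.

(** The closure properties carried by the two subgroups are propositions, so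
proof irrelevance leaves only the carriers to compare. *)
Lemma groupClosedP (H : groupType) (S T : groupClosed H) : S =i T -> S = T.
Proof.
case: S T => [S cS] [T cT] /= ST; have {ST} defT : S = T by apply/funext.
case: _ / defT cT => cT; congr GroupClosed.Pack.
case: cS cT => [[V] [I] [M]] [[V'] [I'] [M']].
by rewrite (Prop_irrelevance V V') (Prop_irrelevance I I')
  (Prop_irrelevance M M').
Qed.

Section CrossedDual.
Variables (G : finGroupType) (A : pzRingType) (act : ringAction G A).
Implicit Types (f : crossed_dual act) (h k : gr (crossed_dual act)).
Implicit Types (x y : G) (a b : A) (u : units A).

(** The exponent comes from moving b to the right of x, where the right
linearity of f applies: f (b x) = f (x b^x). *)
Lemma dual_rscale_monomial f b x :
  (f :* b) (monomial act x 1) = f (monomial act x 1) * rexp act b x.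
Proof.
rewrite rdual_rscaleE -rdualR; congr (f _).
by rewrite [LHS]monomialM [RHS]monomialM mul1g mulg1 rexp1 mulr1 mul1r.
Qed.

Lemma dual_basis_expansion f :
  f = \sum_x f (monomial act x 1) *: dual_basis act x.
Proof. by apply: rdualP => r; rewrite dual_sumE dualE. Qed.

Lemma monomial_expansion_linear (c : G -> A) :
  right_linear (fun r : crossed act => \sum_x c x * ccoef r x).
Proof.
apply/asboolP; split=> [r s|r a].
  by rewrite -big_split; apply: eq_bigr => x _; rewrite ccoefD mulrDr.
by rewrite mulr_suml; apply: eq_bigr => x _; rewrite ccoef_rscale mulrA.
Qed.
Definition dual_of_fun (c : G -> A) : crossed_dual act :=
  RDual (monomial_expansion_linear c).

Lemma dual_of_fun_monomial c x : dual_of_fun c (monomial act x 1) = c x.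
Proof.
rewrite /= (bigD1 x) //= ccoef_monomial eqxx mulr1 big1 ?addr0 // => y yx.
by rewrite ccoef_monomial (negPf yx) mulr0.
Qed.

(** The hypothesis is f x = f f(x) in R^*, for x in G: expanding the second
factor of f \ot f in the dual basis and moving the coefficients across the
tensor sign gives the comultiplication of f. *)
Lemma comul_of_dual_act f :
    (forall x, dual_act f (monomial act x 1) = f :* f (monomial act x 1)) ->
  comul f = f \ot f.
Proof.
move=> f_act; rewrite [X in _ = _ \ot X]dual_basis_expansion.
rewrite (morphD_sum (h := tmk f)); last by move=> *; rewrite tmkDr.
by apply: eq_bigr => x _; rewrite -tmkA f_act.
Qed.

Lemma cocycleM (c : Z1 act) x y : c (x * y)%g = (c y * uexp act (c x) y)%g.
Proof. by case: c => c cP /=; move/forallP/(_ x)/forallP/(_ y)/eqP: (cP). Qed.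

Lemma cocycle1 (c : Z1 act) : c 1%g = 1%g.
Proof.
apply: (mulIg (c 1%g)); rewrite mul1g -[in RHS](mulg1 1%g) cocycleM.
by congr (_ * _)%g; apply: uval_inj; rewrite uval_exp rexp1.
Qed.

(** The cocycle identity c(xy) = c(y) c(x)^y is the value at y of the equation
f x = f f(x) for the right linear extension f of c. *)
Lemma cocycle_grouplike (c : Z1 act) :
  grouplike (dual_of_fun (fun x => uval (c x))).
Proof.
apply/andP; split; apply/eqP; last first.
  by rewrite [LHS](dual_of_fun_monomial _ 1%g) cocycle1.
apply: comul_of_dual_act => x; apply: dual_eq => y.
rewrite dual_rscale_monomial !dual_of_fun_monomial -uval_exp -uvalM -cocycleM.
rewrite -(dual_of_fun_monomial (fun x => uval (c x))).
by congr (dual_of_fun _ _); rewrite monomialM rexp_1 mulr1.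
Qed.
Definition gr_of_cocycle (c : Z1 act) : gr (crossed_dual act) :=
  Gr (cocycle_grouplike c).

Lemma Theta_bijective : bijective (@Theta G A act).
Proof.
exists gr_of_cocycle => [h|c].
  by apply/val_inj/dual_eq => x; rewrite dual_of_fun_monomial ThetaE.
apply/val_inj/ffunP => x; apply: uval_inj.
by rewrite ThetaE dual_of_fun_monomial.
Qed.

Lemma Theta_conj u h x :
  Theta (gr_conj u h) x = (u * Theta h x * uexp act u^-1 x)%g.
Proof.
apply: uval_inj.
by rewrite !uvalM !ThetaE uval_exp [LHS]dual_rscale_monomial rdual_scaleE.
Qed.

Lemma cohomologous_Theta h k :
  cohomologous (Theta h) (Theta k) = gr_orbit_rel h k.
Proof.
apply/asboolP/asboolP => -[u hk]; exists u.
  apply: (bij_inj Theta_bijective); apply/val_inj/ffunP => x.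
  rewrite [RHS]Theta_conj hk !mulgA mulgV mul1g.
  by rewrite -mulgA -uexpM mulgV uexp1 mulg1.
by move=> x; rewrite hk Theta_conj !mulgA mulVg mul1g -mulgA -uexpM mulVg
  uexp1 mulg1.
Qed.

Lemma Theta_trace : Theta (trace act) = trivial_cocycle act.
Proof.
apply/val_inj/ffunP => x; apply: uval_inj.
by rewrite ThetaE trace_monomial ffunE.
Qed.

Lemma coinvariants_trace a :
  reflect (forall x, rexp act a x = a) (a \in coinvariants (trace act)).
Proof.
have at_x x : (a *: trace_fun act) (monomial act x 1) = a.
  by rewrite rdual_scaleE trace_monomial mulr1.
have ta_x x : (trace_fun act :* a) (monomial act x 1) = rexp act a x.
  by rewrite dual_rscale_monomial trace_monomial mul1r.
apply: (iffP eqP) => [/= aT x|aG]; first by rewrite -ta_x -aT at_x.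
by apply: dual_eq => x; rewrite at_x ta_x.
Qed.

Lemma D0_trace : D0 (trace act) = H0 act.
Proof.
apply: groupClosedP => u; apply/andP/forallP => [[/coinvariants_trace uG _] x|uG].
  by apply/eqP/uval_inj; rewrite uval_exp uG.
have {}uG x : uexp act u x = u by apply/eqP.
by split; apply/coinvariants_trace => x; rewrite -uval_exp ?uexpV uG.
Qed.

End CrossedDual.

Theorem theorem1p7 (G : finGroupType) (A : pzRingType) (act : ringAction G A) :
  [/\ bijective (@Theta G A act),
      exists f : D1 (trace act) -> H1 act,
        [/\ bijective f,
            f point = point &
            forall h : gr (crossed_dual act),
              f (gr_orbit (trace act) h) = cohomology_class (Theta h)] &
      D0 (trace act) = H0 act].
Proof.
split; [exact: Theta_bijective| |exact: D0_trace].
have [f [f_bij fE]] :=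
  eq_quot_bijection (Theta_bijective act) (@cohomologous_Theta G A act).
exists f; split=> //.
by rewrite [LHS]fE Theta_trace.
Qed.
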